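(* Let $n\ge 1$, $T>0$, let $u_0:\mathbb{R}^n\to\mathbb{R}$ be Lipschitz continuous, and let $u_1,u_2:\mathbb{R}^n\times(0,T]\to\mathbb{R}$ be two smooth rotationally symmetric solutions of $$u_t=\sum_{i,j=1}^n\Big(\delta^{ij}-\frac{D_iu\,D_ju}{1+|Du|^2}\Big)D_{ij}u$$ with the same initial data $u_0$, that is, $\lim_{t\to0}u_1(\cdot,t)=\lim_{t\to0}u_2(\cdot,t)=u_0$. Then $u_1=u_2$ on $\mathbb{R}^n\times(0,T]$.
   Context: Rotationally symmetric means that $u_i(x,t)$ depends only on $r=|x|$ and $t$. The limits $\lim_{t\to0}u_i(\cdot,t)=u_0$ are understood as uniform convergence on compact subsets of $\mathbb{R}^n$. The equation is the graphical mean curvature flow: it says that the graphs $\{(x,u(x,t)):x\in\mathbb{R}^n\}\subset\mathbb{R}^{n+1}$ evolve by mean curvature. *)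

(* Defs.v *)
From HB Require Import structures.
From mathcomp Require Import all_boot all_order all_algebra.
From mathcomp Require Import all_classical all_reals all_analysis.

Set Implicit Arguments.
Unset Strict Implicit.
Unset Printing Implicit Defensive.

Import Order.TTheory GRing.Theory Num.Theory.
Import numFieldNormedType.Exports.

Local Open Scope classical_set_scope.
Local Open Scope ring_scope.

Section Defs.
Context {R : realType} {n : nat}.

(* The norm `|x| that the library puts on 'rV[R]_n is the max norm; it induces
   the same topology. *)
Definition enorm (x : 'rV[R]_n) : R := Num.sqrt (\sum_i x ord0 i ^+ 2).

Definition lipschitz_continuous (f : 'rV[R]_n -> R) : Prop :=
  exists L : R, forall x y, `|f x - f y| <= L * enorm (x - y).

(* A function on R^n x (0,T] is represented by a total function on
   'rV[R]_n * R; nothing below depends on its values outside slab T. *)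
Definition slab (T : R) : set ('rV[R]_n * R) := [set p | 0 < p.2 <= T].

Implicit Type u : 'rV[R]_n * R -> R.

Definition space_derivable (i : 'I_n) u (p : 'rV[R]_n * R) : Prop :=
  derivable (fun x => u (x, p.2)) p.1 (delta_mx ord0 i).

Definition dx (i : 'I_n) u (p : 'rV[R]_n * R) : R :=
  'D_(delta_mx ord0 i) (fun x => u (x, p.2)) p.1.

(* The increments h are restricted to those with p.2 + h in (0,T]: this is the
   usual derivative when p.2 < T and the left derivative when p.2 = T. *)
Definition time_increments (T : R) (p : 'rV[R]_n * R) : set_system R :=
  within [set h | 0 < p.2 + h <= T] 0^'.

Definition time_quotient u (p : 'rV[R]_n * R) (h : R) : R :=
  h^-1 * (u (p.1, p.2 + h) - u p).

Definition time_derivable (T : R) u (p : 'rV[R]_n * R) : Prop :=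
  cvg (time_quotient u p @ time_increments T p).

Definition dt (T : R) u (p : 'rV[R]_n * R) : R :=
  lim (time_quotient u p @ time_increments T p).

(* All iterated partial derivatives in space and time of order at most k exist
   and are jointly continuous on R^n x (0,T]. *)
Fixpoint class_C (T : R) (k : nat) u : Prop :=
  {within slab T, continuous u} /\
  match k with
  | 0%N => True
  | k'.+1 =>
      (forall p, slab T p ->
         (forall i, space_derivable i u p) /\ time_derivable T u p) /\
      (forall i, class_C T k' (dx i u)) /\
      class_C T k' (dt T u)
  end.

Definition smooth (T : R) u : Prop := forall k, class_C T k u.

Definition rotationally_symmetric (T : R) u : Prop :=
  forall x y t, 0 < t <= T -> enorm x = enorm y -> u (x, t) = u (y, t).

Definition grad u (p : 'rV[R]_n * R) : 'rV[R]_n := \row_i dx i u p.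

Definition graphical_mcf (T : R) u : Prop :=
  forall p, slab T p ->
    dt T u p =
    \sum_(i < n) \sum_(j < n)
      ((i == j)%:R - dx i u p * dx j u p / (1 + enorm (grad u p) ^+ 2))
      * dx i (dx j u) p.

(* Locally uniform convergence on R^n as t decreases to 0. *)
Definition initial_data u (u0 : 'rV[R]_n -> R) : Prop :=
  {family compact, (fun (t : R) (x : 'rV[R]_n) => u (x, t)) @ 0^'+ --> u0}.

End Defs.

(* Main.v *)
Require Import Defs.
From mathcomp Require Import all_boot all_order all_algebra.
From mathcomp Require Import all_classical all_reals all_analysis.
From mathcomp Require Import ring lra.

(** Nothing is assumed about the growth of the two solutions at infinity, so
the maximum principle does not apply directly to w = u1 - u2.  What replaces a
growth condition is that the radial profiles solve
    U_t = (arctan U_r)_r + (k / r) U_r,    k = n - 1,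
whose flux arctan U_r is bounded and monotone in U_r.

In the exterior region r >= 1 this gives a comparison principle without
conditions at infinity (exterior_comparison).  Let U1 be a subsolution and U2
a supersolution with U1 <= U2 on r = 1 and, on bounded sets, for small times.
Put f = max(0, U1 - U2), let c be a cutoff supported in r + k t <= N, and
differentiate the energy, the integral of (c f)^3 over [1, N].  The diffusion
term has a sign because arctan is increasing.  The drift contributes at most k
times the energy, since the cutoff moves inwards with speed k, at least the
speed k / r of the drift.  The remaining term pairs the flux with the slope of
the cutoff; as the difference of two arctangents is at most pi, it is at most
(9 pi / N) (c f)^2, hence at most (c f)^3 + (9 pi / N)^3.  Gronwall's lemma
bounds the energy by a constant times N^(-2), and letting N tend to infinity
forces f = 0.

In the ball r <= 1 compactness is available.  For e > 0, suppose that w - e t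
is positive at some point, and let M be its supremum over the ball and the
times up to that of the point.  If M <= 0, the exterior comparison with U2 + e t + d for small
d > 0 gives a contradiction.  If M > 0, it is attained at a positive time, and
the exterior comparison with U2 + e t + M shows that it is a maximum over all
of space (gap_le0).  At such a point the gradients of u1 and u2 agree, the
pure second derivatives of w are nonpositive, and w_t >= e, which contradicts
the equation (gap_max_absurd).  By rotational symmetry the point may be taken
on the first coordinate axis, where the gradient is parallel to the axis and
mixed second derivatives drop out of the equation (mcf_axis).  Letting e tend
to 0 and exchanging the solutions gives u1 = u2 for t < T, and the time T
follows by continuity. *)

Set Implicit Arguments.
Unset Strict Implicit.
Unset Printing Implicit Defensive.

Import Order.TTheory GRing.Theory Num.Theory.
Import numFieldNormedType.Exports.

Local Open Scope classical_set_scope.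
Local Open Scope ring_scope.

(** * One-variable calculus *)

Section Calculus.
Context {R : realType}.
Implicit Types (f g : R -> R) (x a b c : R).

Lemma is_derive_addf f g x a b : is_derive x 1 f a -> is_derive x 1 g b ->
  is_derive x 1 (fun y => f y + g y) (a + b).
Proof. by move=> ? ?; exact: is_deriveD. Qed.

Lemma is_derive_subf f g x a b : is_derive x 1 f a -> is_derive x 1 g b ->
  is_derive x 1 (fun y => f y - g y) (a - b).
Proof. by move=> ? ?; exact: is_deriveB. Qed.

Lemma is_derive_mulf f g x a b : is_derive x 1 f a -> is_derive x 1 g b ->
  is_derive x 1 (fun y => f y * g y) (a * g x + f x * b).
Proof.
move=> df dg; apply: is_derive_eq (is_deriveM df dg) _.
by rewrite addrC [a * _]mulrC.
Qed.

Lemma is_derive_affine a b x : is_derive x 1 (fun y => a + y * b) b.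
Proof.
have H : is_derive x 1 (fun y => y * b) (1 * b + x * 0).
  exact: is_derive_mulf.
have : is_derive x 1 (fun y => a + y * b) (0 + (1 * b + x * 0)).
  by apply: is_derive_addf H; exact: is_derive_cst.
by rewrite add0r mul1r mulr0 addr0.
Qed.

Lemma is_derive_chain f g x a b :
  is_derive (g x) 1 f a -> is_derive x 1 g b ->
  is_derive x 1 (fun y => f (g y)) (a * b).
Proof. by move=> df dg; exact: is_derive1_comp. Qed.

Lemma is_derive_continuous f x a : is_derive x 1 f a -> {for x, continuous f}.
Proof. by case=> df _; apply/differentiable_continuous/derivable1_diffP. Qed.

Definition pos x := Num.max 0 x.

Lemma pos_ge0 x : 0 <= pos x.
Proof. by rewrite /pos le_max lexx. Qed.

Lemma pos_ge0E x : 0 <= x -> pos x = x.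
Proof. by move=> x0; apply/max_idPr. Qed.

Lemma pos_le0E x : x <= 0 -> pos x = 0.
Proof. by move=> x0; apply/max_idPl. Qed.

Lemma le_pos x : x <= pos x.
Proof. by rewrite /pos le_max lexx orbT. Qed.

Lemma pos_le_norm x : pos x <= `|x|.
Proof. by rewrite /pos ge_max normr_ge0 ler_norm. Qed.

Lemma continuous_pos : continuous pos.
Proof. by move=> x; apply: continuous_max; [exact: cvg_cst|exact: cvg_id]. Qed.

(** Powers of at least two are needed: the first power has a corner at 0. *)
Lemma is_derive_pos_exp m x :
  is_derive x 1 (fun y => pos y ^+ m.+2) (m.+2%:R * pos x ^+ m.+1).
Proof.
have [x0|x0|->] := ltgtP x 0.
- apply: (@near_eq_is_derive _ _ _ (cst 0)).
    near=> y; rewrite pos_le0E ?expr0n//; near: y.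
    by apply: filterS (lt_nbhsl x0) => y /ltW.
  by rewrite (pos_le0E (ltW x0)) expr0n/= mulr0; exact: is_derive_cst.
- apply: (@near_eq_is_derive R R R (fun y : R => y ^+ m.+2)).
    near=> y; rewrite pos_ge0E//; near: y.
    by apply: filterS (lt_nbhsr x0) => y /ltW.
  rewrite (pos_ge0E (ltW x0)).
  have := @is_deriveX R R id m.+2 x 1 1 (is_derive_id x 1).
  by rewrite /= [_ *: _]mulr1 exprfctE.
  (* At the corner, pos y ^+ m.+2 = pos y ^+ m.+1 * y gives the slope 0. *)
- apply/is_derive1_caratheodory; exists (fun y => pos y ^+ m.+1); split.
  + move=> y; rewrite (pos_le0E (lexx 0)) expr0n/= !subr0.
    have [y0|/ltW y0] := leP y 0; first by rewrite pos_le0E// !expr0n/= mul0r.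
    by rewrite pos_ge0E// exprSr.
  + exact: continuous_comp (@continuous_pos _) (@exprn_continuous _ _ _).
  + by rewrite (pos_le0E (lexx 0)) expr0n/= mulr0.
Unshelve. all: by end_near. Qed.

Lemma continuous_atD f g x : {for x, continuous f} -> {for x, continuous g} ->
  {for x, continuous (fun y => f y + g y)}.
Proof. by move=> ? ?; exact: cvgD. Qed.

Lemma continuous_atB f g x : {for x, continuous f} -> {for x, continuous g} ->
  {for x, continuous (fun y => f y - g y)}.
Proof. by move=> ? ?; exact: cvgB. Qed.

Lemma continuous_atM f g x : {for x, continuous f} -> {for x, continuous g} ->
  {for x, continuous (fun y => f y * g y)}.
Proof. by move=> ? ?; exact: cvgM. Qed.

Lemma continuous_atX f n x : {for x, continuous f} ->
  {for x, continuous (fun y => f y ^+ n)}.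
Proof.
move=> cf; apply: (@continuous_comp _ _ _ f (fun y => y ^+ n)) => //.
exact: exprn_continuous.
Qed.

Lemma continuous_at_cst a x : {for x, continuous (fun _ : R => a : R)}.
Proof. exact: cvg_cst. Qed.

Lemma continuous_atV f x : f x != 0 -> {for x, continuous f} ->
  {for x, continuous (fun y => (f y)^-1)}.
Proof. by move=> f0 cf; exact: cvgV. Qed.

(** If g' had positive slope at 0 it would be positive just to the right of 0,
and the mean value theorem would make g exceed g 0 there. *)
Lemma second_derivative_test (g g' : R -> R) (c : R) :
  (forall s : R, is_derive s 1 g (g' s)) -> is_derive (0 : R) 1 g' c ->
  (forall s, g s <= g 0) -> g' 0 = 0 /\ c <= 0.
Proof.
move=> dg dg' gmax.
have g'0 : g' 0 = 0.
  have d0 : is_derive (0 : R) 1 g 0.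
    apply: (@derive1_at_max _ g (-1) 1 0) => //.
    by rewrite in_itv/= ltrN10 ltr01.
  by case: d0 => _; case: (dg 0) => _ ->.
split=> //; have [//|c0] := leP c 0; exfalso.
have [q [q_eq q_cont q0]] := (is_derive1_caratheodory g' 0 c).1 dg'.
have q_pos : \forall s \near (0 : R), 0 < q s.
  have qc : q s @[s --> 0] --> c by rewrite -q0; exact: q_cont.
  exact: cvgr_gt qc _ c0.
have [e /= e0 he] := q_pos.
have e20 : 0 < e / 2 by lra.
have cg : {within `[0, e / 2], continuous g}.
  by apply: continuous_in_subspaceT => x _; exact: is_derive_continuous (dg x).
have [x] := MVT e20 (fun x _ => dg x) cg.
rewrite in_itv/= => /andP[x0 xe].
have := q_eq x; rewrite g'0 !subr0 => ->.
have : 0 < q x by apply: he; rewrite /= sub0r normrN gtr0_norm//; lra.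
move=> qx gE; have := gmax (e / 2); rewrite -subr_le0 gE.
by rewrite leNgt !mulr_gt0.
Qed.

Lemma even_derive0 (g : R -> R) (c : R) :
  is_derive (0 : R) 1 g c -> (forall s, g (- s) = g s) -> c = 0.
Proof.
move=> dg even.
have dgN : is_derive (0 : R) 1 (fun s => g (- s)) (c * (-1)).
  by apply: (is_derive_chain (g := fun s => - s)); rewrite oppr0.
have gE : (fun s => g (- s)) = g by apply/funext.
rewrite gE in dgN.
case: dg => _ c1; case: dgN => _; rewrite c1; lra.
Qed.

(** A maximum at the right end of a time interval suffices for the sign of the
derivative: this is how the maximum principle uses time. *)
Lemma left_max_derivative (g : R -> R) (t c : R) : 0 < t ->
  is_derive t 1 g c -> (forall s, 0 < s <= t -> g s <= g t) -> 0 <= c.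
Proof.
move=> t0 dg gmax; have [//|c0] := leP 0 c; exfalso.
have [q [q_eq q_cont qt]] := (is_derive1_caratheodory g t c).1 dg.
have qc : q s @[s --> t] --> c by rewrite -qt; exact: q_cont.
have [e /= e0 he] := cvgr_lt _ qc _ c0.
pose h := Num.min (e / 2) (t / 2).
have h0 : 0 < h by rewrite lt_min; lra.
have he2 : h <= e / 2 by rewrite ge_min lexx.
have ht2 : h <= t / 2 by rewrite ge_min lexx orbT.
have : q (t - h) < 0.
  by apply: he; rewrite /= opprB addrC subrK gtr0_norm//; lra.
have := q_eq (t - h); have : g (t - h) <= g t by apply: gmax; lra.
move=> + + qh; rewrite -subr_le0 => + gE.
by rewrite gE addrAC subrr add0r nmulr_rle0//; lra.
Qed.

(** The function exp(- a x) E(x) - b x is nonincreasing. *)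
Lemma gronwall (E E' : R -> R) (a b s t : R) :
  0 <= a -> 0 <= b -> 0 <= s -> s <= t ->
  (forall x, s <= x <= t -> is_derive x 1 E (E' x)) ->
  (forall x, s <= x <= t -> E' x <= a * E x + b) ->
  E s = 0 -> E t <= b * t * expR (a * t).
Proof.
move=> a0 b0 s0 st dE leE Es0.
pose H x := expR (0 + x * - a) * E x - (0 + x * b).
have dH x : s <= x <= t ->
    is_derive x 1 H
      (expR (0 + x * - a) * - a * E x + expR (0 + x * - a) * E' x - b).
  move=> hx; apply: is_derive_subf (is_derive_affine 0 b x).
  apply: is_derive_mulf (dE _ hx).
  by apply: is_derive_chain (is_derive_affine 0 (- a) x); exact: is_derive_expR.
have oo x : x \in `]s, t[ -> s <= x <= t.
  by rewrite in_itv/= => /andP[/ltW-> /ltW->].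
have : H t <= H s.
  apply: (@ler0_derive1_le_cc _ H s t); last by [].
  - by move=> x /oo hx; case: (dH _ hx).
  - move=> x /oo hx; rewrite derive1E; case: (dH _ hx) => _ ->.
    have e0 := expR_gt0 (0 + x * - a); have e1 : expR (0 + x * - a) <= 1.
      by rewrite -[leRHS]expR0 ler_expR add0r mulrN oppr_le0 mulr_ge0//; lra.
    have : expR (0 + x * - a) * (E' x - a * E x) <= expR (0 + x * - a) * b.
      by apply: ler_wpM2l; [exact: ltW|rewrite lerBlDl leE].
    have : expR (0 + x * - a) * b <= 1 * b by rewrite ler_wpM2r.
    by lra.
  - apply: continuous_in_subspaceT => x; rewrite inE/= in_itv/= => hx.
    exact: is_derive_continuous (dH _ hx).
  - by rewrite in_itv/= lexx st.
  - by rewrite in_itv/= lexx st.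
rewrite /H Es0 mulr0 !add0r => le1.
have le2 : expR (t * - a) * E t <= b * t.
  have : 0 <= s * b by exact: mulr_ge0.
  by lra.
have -> : E t = expR (a * t) * (expR (t * - a) * E t).
  by rewrite mulrA mulrN [t * a]mulrC expRxMexpNx_1 mul1r.
by rewrite mulrC ler_wpM2r ?expR_ge0.
Qed.

End Calculus.

Arguments continuous_atX {R f} n {x}.

(** * Integrals over segments *)

Section Segment.
Context {R : realType}.
Notation mu := lebesgue_measure.

Lemma integrable_segment (f : R -> R) (a b : R) :
  (forall r, a <= r <= b -> {for r, continuous f}) ->
  mu.-integrable `[a, b] (EFin \o f).
Proof.
move=> cf; apply: continuous_compact_integrable; first exact: segment_compact.
apply: continuous_in_subspaceT => r; rewrite inE/= in_itv/=; exact: cf.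
Qed.

Lemma Rintegral_lower_bound (f : R -> R) (a b c d m : R) :
  a <= c -> c < d -> d <= b ->
  (forall r, a <= r <= b -> {for r, continuous f}) ->
  (forall r, a <= r <= b -> 0 <= f r) ->
  (forall r, c <= r <= d -> m <= f r) ->
  m * (d - c) <= \int[mu]_(r in `[a, b]) f r.
Proof.
move=> ac cd db cf f0 fm.
have mB (x y : R) : measurable (`[x, y]%classic : set (measurableTypeR R)).
  by [].
have sub : (`[c, d]%classic : set R) `<=` `[a, b]%classic.
  by move=> r; rewrite /= !in_itv/= => hr; lra.
have iab : mu.-integrable `[a, b] (EFin \o f) by exact: integrable_segment.
have icd : mu.-integrable `[c, d] (EFin \o f).
  by apply: integrable_segment => r hr; apply: cf; lra.
have -> : m * (d - c) = \int[mu]_(r in `[c, d]) m.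
  rewrite Rintegral_cst//; congr (_ * _).
  by have /= := @lebesgue_measure_itv R `[c, d]; rewrite lte_fin cd => ->.
apply: (@le_trans _ _ (\int[mu]_(r in `[c, d]) f r)).
  apply: le_Rintegral => //.
    by apply: integrable_segment => r _; exact: cvg_cst.
rewrite /Rintegral fine_le ?integrable_fin_num//.
apply: ge0_subset_integral => //; by case/integrableP: iab.
Qed.

End Segment.

(** * Radial profiles and the pointwise flux inequality *)

Section Profile.
Context {R : realType}.

(** P, Q and D stand for U_r, U_rr and U_t.  They are carried as separate
functions, and joint regularity is recorded only through local bounds, because
every later argument differentiates in one variable at a time. *)
Record profile (T : R) (U P Q D : R -> R -> R) : Prop := Profile {
  profile_r : forall t r : R, 0 < t < T -> 0 < r ->
    is_derive r 1 (U t) (P t r);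
  profile_rr : forall t r : R, 0 < t < T -> 0 < r ->
    is_derive r 1 (P t) (Q t r);
  profile_t : forall t r : R, 0 < t < T -> 0 < r ->
    is_derive t 1 (U ^~ r) (D t r);
  profile_rr_continuous : forall t r : R, 0 < t < T -> 0 < r ->
    {for r, continuous (Q t)};
  profile_t_continuous : forall t r : R, 0 < t < T -> 0 < r ->
    {for r, continuous (D t)};
  profile_bounded : forall a b N : R, 0 < a -> b < T -> exists B : R,
    forall t r : R, a <= t <= b -> 1 <= r <= N ->
      `|U t r| <= B /\ `|D t r| <= B }.

(** The graphical mean curvature flow operator on a radial function with
slope p and second derivative q at distance r, in dimension k + 1. *)
Definition radial_mcf (k r p q : R) := q / (1 + p ^+ 2) + k / r * p.

(** The pointwise form of the energy estimate.  With c the cutoff, f the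
excess max(0, U1 - U2), th the difference of the two arctangents, and p, q, d
the differences of the slopes, of the diffusion terms (arctan U_r)_r and of the
time derivatives, it reads
    ((c f)^3)_t <= Flux_r + (k + 1) (c f)^3 + (9 A / N)^3.
The difference of the two sides is a sum of five nonnegative terms: diffusion
(p th >= 0), the differential inequality (d <= q + (k / r) p), the inward
motion of the cutoff (1 / r <= 1), the curvature term k / r^2 <= k, and Young's
inequality for the term where the flux meets the slope of the cutoff. *)
Lemma flux_inequality (A k r N c f d p q th : R) :
  0 <= k -> 1 <= r -> 0 < N -> 0 <= c -> 0 <= f ->
  d <= q + k / r * p -> 0 <= p * th -> `|th| <= A ->
  3 * c ^+ 2 * (- (k / N)) * f ^+ 3 + c ^+ 3 * (3 * f ^+ 2 * d) <=
  3 * c ^+ 2 * (- N^-1) * (3 * f ^+ 2 * th + k * (r^-1 * f ^+ 3)) +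
  c ^+ 3 * (3 * (2 * f * p * th + f ^+ 2 * q) +
            k * (r^-1 * (3 * f ^+ 2 * p) - r^-1 ^+ 2 * f ^+ 3)) +
  ((k + 1) * (c ^+ 3 * f ^+ 3) + (9 * A / N) ^+ 3).
Proof.
move=> k0 r1 N0 c0 f0 dle pth thA.
have r0 : 0 < r by lra.
set i := r^-1; set j := N^-1.
have i0 : 0 < i by rewrite invr_gt0.
have i1 : i <= 1 by rewrite invf_le1.
have j0 : 0 < j by rewrite invr_gt0.
have A0 : 0 <= A by apply: le_trans thA.
have z0 : 0 <= c * f by apply: mulr_ge0.
(* The cube has slack: b z^2 <= z^3 if z >= b, and b z^2 <= b^3 otherwise. *)
have young : 9 * j * (c * f) ^+ 2 * th <= (c * f) ^+ 3 + (9 * A * j) ^+ 3.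
  have b0 : 0 <= 9 * A * j by rewrite !mulr_ge0// ltW.
  have le1 : 9 * j * (c * f) ^+ 2 * th <= (9 * A * j) * (c * f) ^+ 2.
    rewrite [leRHS](_ : _ = 9 * j * (c * f) ^+ 2 * A); last by ring.
    rewrite ler_wpM2l ?(le_trans (ler_norm _) thA)//.
    by rewrite !mulr_ge0 ?exprn_ge0// ltW.
  apply: le_trans le1 _; move: b0 z0.
  set b := 9 * A * j; set z := c * f => b0 z0.
  have [zb|/ltW bz] := leP z b.
    have : b * z ^+ 2 <= b * b ^+ 2 by rewrite ler_wpM2l// lerXn2r.
    have : 0 <= z ^+ 3 by rewrite exprn_ge0.
    by rewrite [b ^+ 3]exprS; lra.
  have : b * z ^+ 2 <= z * z ^+ 2 by rewrite ler_wpM2r// exprn_ge0.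
  have : 0 <= b ^+ 3 by rewrite exprn_ge0.
  by rewrite [z ^+ 3]exprS; lra.
have t1 : 0 <= c ^+ 3 * f * (p * th).
  by apply: mulr_ge0 => //; rewrite mulr_ge0 ?exprn_ge0.
have t2 : 0 <= c ^+ 3 * f ^+ 2 * (q + k * i * p - d).
  by apply: mulr_ge0; rewrite ?subr_ge0// mulr_ge0 ?exprn_ge0.
have t3 : 0 <= k * j * (c ^+ 2 * f ^+ 3) * (1 - i).
  by rewrite !mulr_ge0 ?exprn_ge0 ?subr_ge0// ltW.
have t4 : 0 <= k * (c ^+ 3 * f ^+ 3) * (1 - i ^+ 2).
  by rewrite !mulr_ge0 ?exprn_ge0// subr_ge0 exprn_ile1// ltW.
move: young; rewrite -subr_ge0 => young; rewrite -subr_ge0.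
rewrite [leRHS](_ : _ =
  6 * (c ^+ 3 * f * (p * th)) + 3 * (c ^+ 3 * f ^+ 2 * (q + k * i * p - d)) +
  3 * (k * j * (c ^+ 2 * f ^+ 3) * (1 - i)) +
  k * (c ^+ 3 * f ^+ 3) * (1 - i ^+ 2) +
  ((c * f) ^+ 3 + (9 * A * j) ^+ 3 - 9 * j * (c * f) ^+ 2 * th)).
  by lra.
ring.
Qed.

Lemma atan_diff_monotone (a b : R) : 0 <= (a - b) * (atan a - atan b).
Proof.
have [ab|ba] := leP a b; last move/ltW: ba => ba.
  by rewrite mulr_le0 ?subr_le0// le_atan.
by rewrite mulr_ge0 ?subr_ge0// le_atan.
Qed.

Lemma atan_diff_le (a b : R) : `|atan a - atan b| <= pi.
Proof.
have := atan_gtNpi2 a; have := atan_gtNpi2 b.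
have := atan_ltpi2 a; have := atan_ltpi2 b => *.
by rewrite ler_norml; lra.
Qed.

End Profile.

(** * The localized energy in the exterior region *)

Section Energy.
Context {R : realType}.
Variables (k T : R) (U1 P1 Q1 D1 U2 P2 Q2 D2 : R -> R -> R).
Hypothesis k0 : 0 <= k.
Hypothesis pr1 : profile T U1 P1 Q1 D1.
Hypothesis pr2 : profile T U2 P2 Q2 D2.

(** The support r + k t <= N retreats with speed k, which dominates the speed
k / r of the drift for r >= 1. *)
Definition cutoff (N t r : R) := pos (1 - (r + k * t) / N).
Definition excess (t r : R) := pos (U1 t r - U2 t r).

(** Cubes, because the flux contains the square of the excess, which must be
differentiable where the excess vanishes. *)
Definition energy_density N t r := cutoff N t r ^+ 3 * excess t r ^+ 3.

Definition energy_density_t N t r :=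
  3 * cutoff N t r ^+ 2 * (- (k / N)) * excess t r ^+ 3 +
  cutoff N t r ^+ 3 * (3 * excess t r ^+ 2 * (D1 t r - D2 t r)).

Definition angle (t r : R) := atan (P1 t r) - atan (P2 t r).

Definition unlocalized_flux (t r : R) :=
  3 * excess t r ^+ 2 * angle t r + k * (r^-1 * excess t r ^+ 3).

Definition unlocalized_flux_r (t r : R) :=
  3 * (2 * excess t r * (P1 t r - P2 t r) * angle t r +
       excess t r ^+ 2 *
       (Q1 t r / (1 + P1 t r ^+ 2) - Q2 t r / (1 + P2 t r ^+ 2))) +
  k * (r^-1 * (3 * excess t r ^+ 2 * (P1 t r - P2 t r)) -
       r^-1 ^+ 2 * excess t r ^+ 3).

Definition flux N t r := cutoff N t r ^+ 3 * unlocalized_flux t r.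

Definition flux_r N t r :=
  3 * cutoff N t r ^+ 2 * (- N^-1) * unlocalized_flux t r +
  cutoff N t r ^+ 3 * unlocalized_flux_r t r.

Lemma cutoff_t (N t r : R) :
  is_derive t 1 (fun s => cutoff N s r ^+ 3)
    (3 * cutoff N t r ^+ 2 * (- (k / N))).
Proof.
apply: (is_derive_chain (f := fun y => pos y ^+ 3)).
  exact: (is_derive_pos_exp 1).
rewrite (_ : (fun s => _) = (fun s => (1 - r / N) + s * (- (k / N)))).
  exact: is_derive_affine.
by apply/funext => s; lra.
Qed.

Lemma cutoff_r (N t r : R) :
  is_derive r 1 (fun s => cutoff N t s ^+ 3)
    (3 * cutoff N t r ^+ 2 * (- N^-1)).
Proof.
apply: (is_derive_chain (f := fun y => pos y ^+ 3)).
  exact: (is_derive_pos_exp 1).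
rewrite (_ : (fun s => _) = (fun s => (1 - k * t / N) + s * (- N^-1))).
  exact: is_derive_affine.
by apply/funext => s; lra.
Qed.

Section at_point.
Variables (t r : R).
Hypotheses (ht : 0 < t < T) (hr : 0 < r).

Lemma excess_t m :
  is_derive t 1 (fun s => excess s r ^+ m.+2)
    (m.+2%:R * excess t r ^+ m.+1 * (D1 t r - D2 t r)).
Proof.
apply: (is_derive_chain (f := fun y => pos y ^+ m.+2)).
  exact: is_derive_pos_exp.
apply: is_derive_subf; first exact: profile_t pr1 _ _ _ _.
exact: profile_t pr2 _ _ _ _.
Qed.

Lemma excess_r m :
  is_derive r 1 (fun s => excess t s ^+ m.+2)
    (m.+2%:R * excess t r ^+ m.+1 * (P1 t r - P2 t r)).
Proof.
apply: (is_derive_chain (f := fun y => pos y ^+ m.+2)).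
  exact: is_derive_pos_exp.
apply: is_derive_subf; first exact: profile_r pr1 _ _ _ _.
exact: profile_r pr2 _ _ _ _.
Qed.

Lemma angle_r : is_derive r 1 (angle t)
  (Q1 t r / (1 + P1 t r ^+ 2) - Q2 t r / (1 + P2 t r ^+ 2)).
Proof.
rewrite mulrC [Q2 t r / _]mulrC; apply: is_derive_subf.
  by apply: is_derive_chain (profile_rr pr1 ht hr); exact: is_derive1_atan.
by apply: is_derive_chain (profile_rr pr2 ht hr); exact: is_derive1_atan.
Qed.

Lemma is_derive_energy_density N :
  is_derive t 1 (fun s => energy_density N s r) (energy_density_t N t r).
Proof. by apply: is_derive_mulf; [exact: cutoff_t|exact: (excess_t 1)]. Qed.

Lemma is_derive_unlocalized_flux :
  is_derive r 1 (unlocalized_flux t) (unlocalized_flux_r t r).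
Proof.
have dC (a : R) : is_derive r 1 (fun _ : R => a) 0 by exact: is_derive_cst.
have dV : is_derive r 1 (fun s : R => s^-1) (- r^-1 ^+ 2).
  have := @is_deriveV R id r 1 1 (lt0r_neq0 hr) (is_derive_id r 1).
  by rewrite /= [_ *: _]mulr1 exprVn.
have d := is_derive_addf
  (is_derive_mulf (is_derive_mulf (dC 3) (excess_r 0)) angle_r)
  (is_derive_mulf (dC k) (is_derive_mulf dV (excess_r 1))).
by apply: is_derive_eq d _; rewrite /unlocalized_flux_r; ring.
Qed.

Lemma is_derive_flux N : is_derive r 1 (flux N t) (flux_r N t r).
Proof. exact: is_derive_mulf (cutoff_r N t r) is_derive_unlocalized_flux. Qed.

Lemma continuous_cutoff N : {for r, continuous (cutoff N t)}.
Proof.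
apply: (continuous_comp (f := fun s => 1 - (s + k * t) / N)).
  have cst (a : R) := @continuous_at_cst R a r.
  apply: continuous_atB (cst 1) _; apply: continuous_atM (cst _).
  by apply: continuous_atD (cst _); exact: cvg_id.
exact: continuous_pos.
Qed.

Lemma continuous_excess : {for r, continuous (excess t)}.
Proof.
apply: (continuous_comp (f := fun s => U1 t s - U2 t s));
  last exact: continuous_pos.
apply: continuous_atB; apply: is_derive_continuous.
  exact: profile_r pr1 _ _ _ _.
exact: profile_r pr2 _ _ _ _.
Qed.

Lemma continuous_energy_density N : {for r, continuous (energy_density N t)}.
Proof.
exact (continuous_atM (continuous_atX 3 (@continuous_cutoff N))
                      (continuous_atX 3 continuous_excess)).
Qed.

Lemma continuous_energy_density_t N :
  {for r, continuous (energy_density_t N t)}.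
Proof.
have cst (a : R) := @continuous_at_cst R a r.
have cX m := continuous_atX m (@continuous_cutoff N).
have fX m := continuous_atX m continuous_excess.
have cD := continuous_atB (profile_t_continuous pr1 ht hr)
                          (profile_t_continuous pr2 ht hr).
exact (continuous_atD
  (continuous_atM (continuous_atM (continuous_atM (cst 3) (cX 2%N)) (cst _))
                  (fX 3%N))
  (continuous_atM (cX 3%N)
    (continuous_atM (continuous_atM (cst 3) (fX 2%N)) cD))).
Qed.

Lemma continuous_unlocalized_flux_r :
  {for r, continuous (unlocalized_flux_r t)}.
Proof.
have cst (a : R) := @continuous_at_cst R a r.
have cf := continuous_excess; have fX m := continuous_atX m cf.
have cP1 := is_derive_continuous (profile_rr pr1 ht hr).
have cP2 := is_derive_continuous (profile_rr pr2 ht hr).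
have cP := continuous_atB cP1 cP2.
have cA := is_derive_continuous angle_r.
have ci : {for r, continuous (fun s : R => s^-1)}.
  by apply: continuous_atV; [exact: lt0r_neq0|exact: cvg_id].
have curv (P Q : R -> R) : {for r, continuous P} -> {for r, continuous Q} ->
    {for r, continuous (fun s => Q s / (1 + P s ^+ 2))}.
  move=> hP hQ; apply: continuous_atM hQ _; apply: continuous_atV.
    by rewrite lt0r_neq0// ltr_wpDr ?sqr_ge0.
  exact: continuous_atD (cst 1) (continuous_atX 2 hP).
have cQ := continuous_atB (curv _ _ cP1 (profile_rr_continuous pr1 ht hr))
                          (curv _ _ cP2 (profile_rr_continuous pr2 ht hr)).
have c1 := continuous_atM (continuous_atM (continuous_atM (cst 2) cf) cP) cA.
have c2 := continuous_atM (fX 2%N) cQ.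
have c3 := continuous_atM ci
  (continuous_atM (continuous_atM (cst 3) (fX 2%N)) cP).
have c4 := continuous_atM (continuous_atX 2 ci) (fX 3%N).
exact (continuous_atD (continuous_atM (cst 3) (continuous_atD c1 c2))
                      (continuous_atM (cst k) (continuous_atB c3 c4))).
Qed.

Lemma continuous_flux_r N : {for r, continuous (flux_r N t)}.
Proof.
have cst (a : R) := @continuous_at_cst R a r.
have cX m := continuous_atX m (@continuous_cutoff N).
have cE := is_derive_continuous is_derive_unlocalized_flux.
exact (continuous_atD
  (continuous_atM (continuous_atM (continuous_atM (cst 3) (cX 2%N)) (cst _)) cE)
  (continuous_atM (cX 3%N) continuous_unlocalized_flux_r)).
Qed.

End at_point.

Notation mu := lebesgue_measure.

Definition energy (N t : R) := \int[mu]_(r in `[1, N]) energy_density N t r.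

Lemma cutoff_le1 (N t r : R) : 0 < N -> 0 <= t -> 0 <= r -> cutoff N t r <= 1.
Proof.
move=> N0 t0 r0; rewrite /cutoff /pos ge_max ler01/= gerBl.
by rewrite divr_ge0 ?addr_ge0 ?mulr_ge0// ltW.
Qed.

Lemma energy_density_t_bounded (N a b : R) : 0 < N -> 0 < a -> b < T ->
  exists2 B : R, 0 <= B & forall t r, a <= t <= b -> 1 <= r <= N ->
    `|energy_density_t N t r| <= B.
Proof.
move=> N0 a0 bT.
have [B1 h1] := profile_bounded pr1 N a0 bT.
have [B2 h2] := profile_bounded pr2 N a0 bT.
exists (3 * (k / N) * (`|B1| + `|B2|) ^+ 3 +
  3 * (`|B1| + `|B2|) ^+ 2 * (`|B1| + `|B2|)).
  by rewrite addr_ge0// !mulr_ge0// ?exprn_ge0// ?addr_ge0// invr_ge0 ltW.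
move=> t r ht hr; have [u1 d1] := h1 _ _ ht hr; have [u2 d2] := h2 _ _ ht hr.
have c1 : cutoff N t r <= 1 by apply: cutoff_le1 => //; lra.
have c0 : 0 <= cutoff N t r by exact: pos_ge0.
have f0 : 0 <= excess t r by exact: pos_ge0.
have fB : excess t r <= `|B1| + `|B2|.
  apply: le_trans (pos_le_norm _) _; apply: le_trans (ler_normB _ _) _.
  by apply: lerD; [apply: le_trans u1 _|apply: le_trans u2 _]; exact: ler_norm.
have dB : `|D1 t r - D2 t r| <= `|B1| + `|B2|.
  apply: le_trans (ler_normB _ _) _.
  by apply: lerD; [apply: le_trans d1 _|apply: le_trans d2 _]; exact: ler_norm.
have kN0 : 0 <= k / N by rewrite divr_ge0// ltW.
have fX m : 0 <= excess t r ^+ m <= (`|B1| + `|B2|) ^+ m.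
  by rewrite exprn_ge0//= lerXn2r ?nnegrE ?addr_ge0.
have cX m : 0 <= cutoff N t r ^+ m <= 1 by rewrite exprn_ge0//= exprn_ile1.
rewrite /energy_density_t; move: (fX 2%N) (fX 3%N) (cX 2%N) (cX 3%N).
set f2 := excess t r ^+ 2; set f3 := excess t r ^+ 3.
set c2 := cutoff N t r ^+ 2; set c3 := cutoff N t r ^+ 3.
move=> /andP[f20 f2B] /andP[f30 f3B] /andP[c20 c21] /andP[c30 c31].
apply: le_trans (ler_normD _ _) _; apply: lerD.
  rewrite mulrN mulNr normrN ger0_norm; last by do 3!apply: mulr_ge0 => //.
  apply: ler_pM => //; first by do 2!apply: mulr_ge0 => //.
  by rewrite ler_wpM2r// ler_piMr.
rewrite normrM (ger0_norm c30) -[leRHS]mul1r; apply: ler_pM => //.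
rewrite normrM (ger0_norm (mulr_ge0 _ f20))//.
by apply: ler_pM => //; [rewrite mulr_ge0|rewrite ler_wpM2l].
Qed.

(** Differentiation under the integral sign, on a time interval around t that
stays away from the endpoints 0 and T, where the time derivatives may be
unbounded. *)
Lemma is_derive_energy (N t : R) : 1 <= N -> 0 < t < T ->
  is_derive t 1 (energy N) (\int[mu]_(r in `[1, N]) energy_density_t N t r).
Proof.
move=> N1 ht.
have N0 : 0 < N by lra.
have sub s : `]t / 2, (t + T) / 2[%classic s -> 0 < s < T.
  by rewrite /= in_itv/= => hs; lra.
have It : `]t / 2, (t + T) / 2[%classic t by rewrite /= in_itv/=; lra.
have mB : measurable (`[1, N]%classic : set (measurableTypeR R)) by [].
have r0 r : `[1, N]%classic r -> 0 < r :> R by rewrite /= in_itv/= => hr; lra.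
have intf s : `]t / 2, (t + T) / 2[%classic s ->
    mu.-integrable `[1, N] (EFin \o energy_density N s).
  move=> /sub hs; apply: integrable_segment => r hr.
  by apply: continuous_energy_density => //; lra.
have dE s r : `]t / 2, (t + T) / 2[%classic s -> `[1, N]%classic r ->
    is_derive s 1 (energy_density N ^~ r) (energy_density_t N s r).
  by move=> /sub hs /r0 hr; exact: is_derive_energy_density.
have derf s r : `]t / 2, (t + T) / 2[%classic s -> `[1, N]%classic r ->
    derivable (energy_density N ^~ r) s 1.
  by move=> hs hr; case: (dE _ _ hs hr).
have [B B0 hB] : exists2 B : R, 0 <= B & forall s r,
    t / 2 <= s <= (t + T) / 2 -> 1 <= r <= N -> `|energy_density_t N s r| <= B.
  by apply: energy_density_t_bounded => //; lra.
have pE s r : `]t / 2, (t + T) / 2[%classic s -> `[1, N]%classic r ->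
    partial1of2 (energy_density N) s r = energy_density_t N s r.
  by move=> hs hr; rewrite partial1of2E; case: (dE _ _ hs hr).
have Gub s r : `]t / 2, (t + T) / 2[%classic s -> `[1, N]%classic r ->
    `|partial1of2 (energy_density N) s r| <= cst B r.
  move=> hs hr; rewrite pE//; apply: hB.
    by move: hs; rewrite /= in_itv/= => /andP[/ltW-> /ltW->].
  by move: hr; rewrite /= in_itv.
have intG : mu.-integrable `[1, N] (EFin \o (cst B : R -> R)).
  by apply: integrable_segment => r _; exact: cvg_cst.
have d := derivable_under_integral mB It intf derf (fun=> B0) intG Gub.
have := differentiation_under_integral mB It intf derf (fun=> B0) intG Gub.
rewrite derive1E => e.
apply: DeriveDef => //; rewrite e; apply: eq_Rintegral => r.
by rewrite inE => hr; exact: pE.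
Qed.

(** The flux integrates to zero: it vanishes at r = N because of the cutoff and
at r = 1 because the excess does.  What remains of flux_inequality is small
because the constant (9 pi / N)^3 is integrated over a length of order N. *)
Lemma energy_t_le (N t : R) : 1 < N -> 0 < t < T ->
  (forall r, 1 <= r -> D1 t r <= radial_mcf k r (P1 t r) (Q1 t r)) ->
  (forall r, 1 <= r -> radial_mcf k r (P2 t r) (Q2 t r) <= D2 t r) ->
  U1 t 1 <= U2 t 1 ->
  \int[mu]_(r in `[1, N]) energy_density_t N t r <=
    (k + 1) * energy N t + (9 * pi / N) ^+ 3 * (N - 1).
Proof.
move=> N1 ht sub1 sup2 bd1.
have N0 : 0 < N by lra.
have mB : measurable (`[1, N]%classic : set (measurableTypeR R)) by [].
have cst (a r : R) := @continuous_at_cst R a r.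
have cFlux r : 1 <= r -> {for r, continuous (flux_r N t)}.
  by move=> r1; apply: continuous_flux_r => //; lra.
have cE r : 1 <= r -> {for r, continuous (energy_density N t)}.
  by move=> r1; apply: continuous_energy_density => //; lra.
have cEt r : 1 <= r -> {for r, continuous (energy_density_t N t)}.
  by move=> r1; apply: continuous_energy_density_t => //; lra.
pose rest r := (k + 1) * energy_density N t r + (9 * pi / N) ^+ 3.
have cRest r : 1 <= r -> {for r, continuous rest}.
  by move=> r1; exact: continuous_atD (continuous_atM (cst _ _) (cE _ r1)) _.
have int (g : R -> R) : (forall r, 1 <= r -> {for r, continuous g}) ->
    mu.-integrable `[1, N] (EFin \o g).
  by move=> cg; apply: integrable_segment => r /andP[r1 _]; exact: cg.
have flux0 : \int[mu]_(r in `[1, N]) flux_r N t r = 0.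
  rewrite /Rintegral (continuous_FTC2 (F := flux N t) N1)/=.
  - have -> : flux N t N = 0.
      have t0 : 0 <= t by lra.
      rewrite /flux /cutoff pos_le0E ?expr0n/= ?mul0r//.
      rewrite mulrDl divff ?lt0r_neq0// subr_le0 lerDl.
      by rewrite divr_ge0 ?mulr_ge0// ltW.
    have -> : flux N t 1 = 0.
      by rewrite /flux /unlocalized_flux /excess pos_le0E ?subr_le0// !expr0n/=
        !(mulr0, mul0r, addr0).
    by rewrite subrr.
  - apply: continuous_in_subspaceT => r; rewrite inE/= in_itv/= => hr.
    by apply: cFlux; case/andP: hr.
  - have df (r : R) : 1 <= r -> is_derive r 1 (flux N t) (flux_r N t r).
      by move=> hr; apply: is_derive_flux => //; lra.
    have cf (r : R) : 1 <= r -> {for r, continuous (flux N t)}.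
      by move=> hr; exact: is_derive_continuous (df _ hr).
    split.
    + by move=> r; rewrite in_itv/= => /andP[/ltW hr _]; case: (df _ hr).
    + exact/cvg_at_right_filter/cf.
    + by apply/cvg_at_left_filter/cf; exact: ltW.
  - move=> r; rewrite in_itv/= => hr; rewrite derive1E.
    have [] : is_derive r 1 (flux N t) (flux_r N t r); last by move=> _ ->.
    by apply: is_derive_flux => //; lra.
have -> : (k + 1) * energy N t + (9 * pi / N) ^+ 3 * (N - 1) =
    \int[mu]_(r in `[1, N]) (flux_r N t r + rest r).
  rewrite RintegralD//; [|exact: int|exact: int].
  rewrite flux0 add0r RintegralD//; last by apply: int => r _; exact: cst.
    rewrite RintegralZl//; last exact: int.
    congr (_ + _); rewrite Rintegral_cst//; congr (_ * _).
    by have /= := @lebesgue_measure_itv R `[1, N]; rewrite lte_fin N1 => ->.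
  by apply: int => r r1; exact: continuous_atM (cst _ _) (cE _ r1).
apply: le_Rintegral => //; [exact: int| |].
  by apply: int => r r1; exact: continuous_atD (cFlux _ r1) (cRest _ r1).
move=> r; rewrite /= in_itv/= => /andP[r1 _].
apply: flux_inequality => //.
- exact: pos_ge0.
- exact: pos_ge0.
- by have := sub1 _ r1; have := sup2 _ r1; rewrite /radial_mcf; lra.
- exact: atan_diff_monotone.
- exact: atan_diff_le.
Qed.

End Energy.

(** * Comparison outside the unit ball *)

Section Comparison.
Context {R : realType}.
Notation mu := lebesgue_measure.

(** Comparison of a subsolution with a supersolution outside the unit ball,
without any condition at infinity.  If the excess were positive at (t1, r0), it
would bound the energy below by a constant e0 for all large N, whereas
Gronwall's lemma gives the upper bound C / N. *)
Lemma exterior_comparison (k T t1 : R)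
    (U1 P1 Q1 D1 U2 P2 Q2 D2 : R -> R -> R) :
  0 <= k -> profile T U1 P1 Q1 D1 -> profile T U2 P2 Q2 D2 -> 0 < t1 < T ->
  (forall t r : R, 0 < t <= t1 -> 1 <= r ->
    D1 t r <= radial_mcf k r (P1 t r) (Q1 t r)) ->
  (forall t r : R, 0 < t <= t1 -> 1 <= r ->
    radial_mcf k r (P2 t r) (Q2 t r) <= D2 t r) ->
  (forall t : R, 0 < t <= t1 -> U1 t 1 <= U2 t 1) ->
  (forall N : R, exists2 s : R, 0 < s &
     forall t r : R, 0 < t <= s -> t < T -> 1 <= r <= N -> U1 t r <= U2 t r) ->
  forall r, 1 <= r -> U1 t1 r <= U2 t1 r.
Proof.
move=> k0 pr1 pr2 ht1 sub1 sup2 bd init r0 r01.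
have [//|lt12] := leP (U1 t1 r0) (U2 t1 r0); exfalso.
pose d := U1 t1 r0 - U2 t1 r0.
have d0 : 0 < d by rewrite subr_gt0.
have cW r : 1 <= r -> {for r, continuous (fun r => U1 t1 r - U2 t1 r)}.
  move=> r1; apply: continuous_atB; apply: is_derive_continuous.
    by apply: profile_r pr1 _ _ _ _ => //; lra.
  by apply: profile_r pr2 _ _ _ _ => //; lra.
have [h h0 hW] : exists2 h : R, 0 < h &
    forall r, r0 <= r <= r0 + h -> d / 2 <= U1 t1 r - U2 t1 r.
  have /cvgrPdist_le /(_ (d / 2)) := cW _ r01.
  move=> /(_ (divr_gt0 d0 (ltr0n _ 2))) [e /= e0 he].
  exists (e / 2); first by rewrite divr_gt0.
  move=> r hr.
  have /he : `|r0 - r| < e by rewrite distrC ger0_norm; lra.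
  by rewrite /= -/d ler_norml; lra.
pose a := k + 1; pose C := (9 * pi) ^+ 3 * t1 * expR (a * t1).
have C0 : 0 <= C.
  by rewrite !mulr_ge0 ?expR_ge0 ?exprn_ge0 ?mulr_ge0 ?pi_ge0//; lra.
pose e0 := (1 / 2) ^+ 3 * (d / 2) ^+ 3 * (r0 + h - r0).
have e00 : 0 < e0.
  by rewrite mulr_gt0 ?mulr_gt0 ?exprn_gt0 ?divr_gt0//; lra.
(* The first summand makes the cutoff at least 1/2 on [r0, r0 + h] at time t1,
   the second makes e0 * N exceed C. *)
pose N := 2 * (r0 + h + k * t1) + C / e0 + 1.
have kt0 : 0 <= k * t1 by rewrite mulr_ge0//; lra.
have Ce0 : 0 <= C / e0 by rewrite divr_ge0// ltW.
have N1 : 1 < N by rewrite /N; lra.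
have N0 : 0 < N by lra.
have lower : e0 <= energy k U1 U2 N t1.
  apply: Rintegral_lower_bound => //; rewrite ?ltrDl//.
  - by rewrite /N; lra.
  - by move=> r hr; apply: (continuous_energy_density pr1 pr2) => //; lra.
  - by move=> r _; rewrite mulr_ge0 ?exprn_ge0 ?pos_ge0.
  - move=> r hr; have d20 : 0 <= d / 2 by lra.
    have c12 : 1 / 2 <= cutoff k N t1 r.
      apply: le_trans (le_pos _).
      have : (r + k * t1) / N <= 1 / 2 by rewrite ler_pdivrMr// /N; lra.
      by lra.
    have d2e : d / 2 <= excess U1 U2 t1 r.
      by apply: le_trans (le_pos _); exact: hW.
    by apply: ler_pM; rewrite ?exprn_ge0 ?lerXn2r ?nnegrE ?pos_ge0//; lra.
have [s s0 hs] := init N.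
(* At time s' the excess vanishes on [1, N], so the energy starts from 0. *)
pose s' := Num.min s t1.
have s'0 : 0 < s' by rewrite lt_min s0; lra.
have s't1 : s' <= t1 by rewrite ge_min lexx orbT.
have s's : s' <= s by rewrite ge_min lexx.
have upper : energy k U1 U2 N t1 <=
    (9 * pi / N) ^+ 3 * (N - 1) * t1 * expR (a * t1).
  apply: (@gronwall _ (energy k U1 U2 N)
    (fun t => \int[mu]_(r in `[1, N]) energy_density_t k U1 D1 U2 D2 N t r)
    a _ s').
  - by rewrite /a; lra.
  - by rewrite mulr_ge0 ?exprn_ge0 ?divr_ge0 ?mulr_ge0 ?pi_ge0//; lra.
  - exact: ltW.
  - by [].
  - by move=> t ht; apply: (is_derive_energy k0 pr1 pr2); lra.
  - move=> t ht; apply: (energy_t_le k0 pr1 pr2) => //; first by lra.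
    + by move=> r hr; apply: sub1 => //; lra.
    + by move=> r hr; apply: sup2 => //; lra.
    + by apply: bd; lra.
  - have -> : energy k U1 U2 N s' = \int[mu]_(r in `[1, N]) (0 : R).
      apply: eq_Rintegral => r; rewrite inE/= in_itv/= => hr.
      rewrite /energy_density /excess pos_le0E ?expr0n ?mulr0//.
      by rewrite subr_le0 hs//; lra.
    by rewrite Rintegral_cst ?mul0r.
have : e0 * N <= C.
  rewrite -ler_pdivlMr//; apply: le_trans lower (le_trans upper _).
  rewrite /C [leRHS]mulrAC ler_wpM2r ?expR_ge0//.
  rewrite [leRHS]mulrAC ler_wpM2r//; first by lra.
  rewrite exprMn -[leLHS]mulrA ler_wpM2l//.
    by rewrite exprn_ge0// mulr_ge0 ?pi_ge0.
  rewrite exprVn ler_pdivrMl ?exprn_gt0// exprSr mulfK ?gt_eqF//.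
  by rewrite expr2; nra.
have : e0 * N = e0 * (2 * (r0 + h + k * t1) + 1) + C.
  by rewrite /N; field; rewrite gt_eqF.
have : 0 < e0 * (2 * (r0 + h + k * t1) + 1) by rewrite mulr_gt0//; lra.
by lra.
Qed.

End Comparison.

(** * The flow on the symmetry axis *)

Section Line.
Context {R : realType} {m : nat}.
Notation V := 'rV[R]_m.+1.
Implicit Types (x y v : V).

Lemma is_derive_line (f : V -> R) y v (s : R) :
  derivable f (y + s *: v) v ->
  is_derive s 1 (fun s => f (y + s *: v)) ('D_v f (y + s *: v)).
Proof.
move=> df.
have E : (fun h : R => h^-1 *: (((fun s => f (y + s *: v)) \o shift s) (h *: 1)
                               - f (y + s *: v))) =
    (fun h : R => h^-1 *: ((f \o shift (y + s *: v)) (h *: v) -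
                           f (y + s *: v))).
  apply/funext => h /=; congr (_ *: (f _ - _)).
  by rewrite [h%:A]mulr1 scalerDl addrCA.
by apply: DeriveDef; rewrite /derivable/derive E.
Qed.

Definition axis (i : 'I_m.+1) : V := delta_mx ord0 i.

Lemma enorm_axes (r s : R) (j : 'I_m.+1) : j != ord0 ->
  enorm (r *: axis ord0 + s *: axis j) = Num.sqrt (r ^+ 2 + s ^+ 2).
Proof.
move=> j0; rewrite /enorm; congr Num.sqrt.
rewrite (bigD1 ord0)//= (bigD1 j)//= big1 => [|i /andP[i0 ij]].
  rewrite !mxE !eqxx/= (negbTE j0) eq_sym (negbTE j0).
  by rewrite !(mulr1, mulr0, addr0, add0r).
by rewrite !mxE/= (negbTE i0) (negbTE ij) !mulr0 addr0 expr0n.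
Qed.

Lemma enorm_axis (r : R) : enorm (r *: axis ord0) = `|r|.
Proof.
rewrite /enorm (bigD1 ord0)//= big1 => [|i i0].
  by rewrite !mxE !eqxx/= mulr1 addr0 sqrtr_sqr.
by rewrite !mxE/= (negbTE i0) mulr0 expr0n.
Qed.

Lemma enorm_ge0 (x : V) : 0 <= enorm x.
Proof. exact: sqrtr_ge0. Qed.

Variables (T : R) (u : V * R -> R).
Hypotheses (smu : smooth T u) (rsu : rotationally_symmetric T u).

Lemma smooth_continuous : [/\ {within slab T, continuous u},
  forall i, {within slab T, continuous (dx i u)},
  forall i j, {within slab T, continuous (dx i (dx j u))} &
  {within slab T, continuous (dt T u)}].
Proof.
have /= [cu [_ [cdx [cdt _]]]] := smu 3.
split; [exact: cu| | |exact: cdt].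
  by move=> i; case: (cdx i).
by move=> i j; have [_ [_ [/(_ i) [cdd _] _]]] := cdx j.
Qed.

Lemma smooth_derivable p : slab T p -> [/\ forall i, space_derivable i u p,
  forall i j, space_derivable i (dx j u) p & time_derivable T u p].
Proof.
move=> sp; have /= [_ [du [ddx _]]] := smu 3.
have [dxu dtu] := du _ sp; split; [exact: dxu| |exact: dtu].
by move=> i j; have [_ [/(_ _ sp) [dij _] _]] := ddx j; exact: dij.
Qed.

Lemma is_derive_along (y : V) (t s : R) (i : 'I_m.+1) : 0 < t <= T ->
  is_derive s 1 (fun s => u (y + s *: axis i, t)) (dx i u (y + s *: axis i, t)).
Proof.
move=> ht; apply: (is_derive_line (f := fun x => u (x, t))).
by have [/(_ i)] := @smooth_derivable (y + s *: axis i, t) ht.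
Qed.

Lemma is_derive_dx_along (y : V) (t s : R) (i j : 'I_m.+1) : 0 < t <= T ->
  is_derive s 1 (fun s => dx j u (y + s *: axis i, t))
    (dx i (dx j u) (y + s *: axis i, t)).
Proof.
move=> ht; apply: (is_derive_line (f := fun x => dx j u (x, t))).
by have [_ /(_ i j)] := @smooth_derivable (y + s *: axis i, t) ht.
Qed.

(** At an interior time the restriction of the increments to (0,T] is void
near 0, so the one-sided convention at T does not show. *)
Lemma is_derive_time (x : V) (t : R) : 0 < t < T ->
  is_derive t 1 (fun s => u (x, s)) (dt T u (x, t)).
Proof.
move=> ht; have ht' : 0 < t <= T by lra.
have [_ _ du] := @smooth_derivable (x, t) ht'.
have E : (fun h : R => h^-1 *: (((fun s => u (x, s)) \o shift t) (h *: 1) -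
    u (x, t))) = time_quotient u (x, t).
  apply/funext => h /=; rewrite /time_quotient/=.
  by rewrite [h%:A]mulr1 [h + t]addrC.
have inc : time_increments T (x, t) = 0^'.
  apply/seteqP; split=> A.
    rewrite /time_increments /within/= => hA.
    have ev : \forall h \near (0 : R)^', 0 < t + h <= T.
      apply: nbhs_dnbhs; exists (Num.min t (T - t)) => /=.
        by rewrite lt_min; lra.
      by move=> h /=; rewrite sub0r normrN lt_min !ltr_norml; lra.
    by apply: filterS2 hA ev => h; apply.
  by rewrite /time_increments /within/=; apply: filterS.
apply: DeriveDef; rewrite /derivable /derive E.
  by move: du; rewrite /time_derivable inc.
by rewrite /dt inc.
Qed.

(** The reflection of the j-th coordinate fixes the axis and preserves u. *)
Lemma dx_axis0 (r t : R) (j : 'I_m.+1) : 0 < t <= T -> j != ord0 ->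
  dx j u (r *: axis ord0, t) = 0.
Proof.
move=> ht j0.
have := is_derive_along (r *: axis ord0) 0 j ht.
rewrite scale0r addr0 => d; apply: even_derive0 d _ => s.
by apply: rsu => //; rewrite !enorm_axes// sqrrN.
Qed.

(** Along the line through r e_0 in direction e_j the solution is
U(rho), rho = sqrt(r^2 + s^2), so its slope is (U'(rho) / rho) s, whose
derivative at s = 0 is U'(r) / r. *)
Lemma dxx_axis (r t : R) (j : 'I_m.+1) : 0 < t <= T -> 0 < r -> j != ord0 ->
  dx j (dx j u) (r *: axis ord0, t) = dx ord0 u (r *: axis ord0, t) / r.
Proof.
move=> ht r0 j0.
pose rho s : R := Num.sqrt (r ^+ 2 + s ^+ 2).
have rs0 s : 0 < r ^+ 2 + s ^+ 2 by rewrite ltr_wpDr ?sqr_ge0 ?exprn_gt0.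
have rho0 s : 0 < rho s by rewrite sqrtr_gt0.
have rhoE : rho 0 = r by rewrite /rho expr0n addr0 sqrtr_sqr gtr0_norm.
pose P s := dx ord0 u (s *: axis ord0, t).
have dP (s : R) : is_derive s 1 (fun s => u (s *: axis ord0, t)) (P s).
  have := is_derive_along 0 s ord0 ht.
  by rewrite add0r; under eq_fun do rewrite add0r.
have cP : continuous P.
  move=> s; have := is_derive_dx_along 0 s ord0 ord0 ht.
  by under eq_fun do rewrite add0r; exact: is_derive_continuous.
have drho (s : R) : is_derive s 1 rho (s / rho s).
  have d2 : is_derive s 1 (fun s => r ^+ 2 + s ^+ 2) (2 * s).
    have ds : is_derive s 1 (fun s : R => s * s) (1 * s + s * 1).
      exact: is_derive_mulf.
    have : is_derive s 1 (fun s : R => r ^+ 2 + s * s) (0 + (1 * s + s * 1)).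
      by apply: is_derive_addf ds; exact: is_derive_cst.
    by rewrite add0r mul1r mulr1 -mulr2n mulr_natl.
  have ds : is_derive (r ^+ 2 + s ^+ 2) 1 Num.sqrt (2 * rho s)^-1.
    exact: is_derive1_sqrt.
  have -> : s / rho s = (2 * rho s)^-1 * (2 * s).
    by field; rewrite gt_eqF.
  exact: (is_derive_chain (g := fun s => r ^+ 2 + s ^+ 2) ds d2).
have d1 s : dx j u (r *: axis ord0 + s *: axis j, t) = P (rho s) * (s / rho s).
  have dd := is_derive_along (r *: axis ord0) s j ht.
  have : is_derive s 1 (fun s => u (rho s *: axis ord0, t))
      (P (rho s) * (s / rho s)).
    exact: is_derive_chain (dP _) (drho s).
  rewrite (_ : (fun s => _) = (fun s => u (r *: axis ord0 + s *: axis j, t))).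
    by case: dd => _ <- [_ <-].
  apply/funext => s'; apply: rsu => //.
  by rewrite enorm_axis enorm_axes// gtr0_norm.
have := is_derive_dx_along (r *: axis ord0) 0 j j ht.
under eq_fun do rewrite d1.
rewrite scale0r addr0 => d2.
have d3 : is_derive (0 : R) 1 (fun s => P (rho s) * (s / rho s)) (P r / r).
  apply/is_derive1_caratheodory; exists (fun s => P (rho s) / rho s); split.
  - by move=> s; rewrite mul0r mulr0 !subr0; ring.
  - have crho : {for 0, continuous rho} := is_derive_continuous (drho 0).
    apply: continuous_atM; first exact: (continuous_comp crho (cP _)).
    by apply: continuous_atV => //; rewrite gt_eqF.
  - by rewrite rhoE.
by case: d2 => _ <-; case: d3 => _ ->.
Qed.

(** On the axis the gradient is parallel to e_0.  Hence every off-diagonal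
coefficient vanishes, and the diagonal ones are 1 except for the coefficient
1 - p^2 / (1 + p^2) = 1 / (1 + p^2) in the direction of the axis.  The origin
is included, which lets the maximum principle treat it like any other point. *)
Lemma mcf_axis (r t : R) : graphical_mcf T u -> 0 < t <= T ->
  dt T u (r *: axis ord0, t) =
  dx ord0 (dx ord0 u) (r *: axis ord0, t)
    / (1 + dx ord0 u (r *: axis ord0, t) ^+ 2) +
  \sum_(i < m) dx (lift ord0 i) (dx (lift ord0 i) u) (r *: axis ord0, t).
Proof.
move=> mcf ht; rewrite mcf//; set p := (_, t).
have gE : enorm (grad u p) ^+ 2 = dx ord0 u p ^+ 2.
  rewrite /enorm sqr_sqrtr; last by apply: sumr_ge0 => i _; exact: sqr_ge0.
  rewrite (bigD1 ord0)//= big1 => [|i i0]; rewrite !mxE ?addr0//.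
  by rewrite dx_axis0// expr0n.
rewrite gE.
have diag i : \sum_(j < m.+1)
      ((i == j)%:R - dx i u p * dx j u p / (1 + dx ord0 u p ^+ 2))
      * dx i (dx j u) p =
    (1 - dx i u p ^+ 2 / (1 + dx ord0 u p ^+ 2)) * dx i (dx i u) p.
  rewrite (bigD1 i)//= eqxx -expr2 big1 ?addr0// => j ji.
  rewrite eq_sym (negbTE ji) sub0r.
  have [i0|i0] := eqVneq i ord0.
    by rewrite (@dx_axis0 _ _ j)// -?i0// mulr0 mul0r oppr0 mul0r.
  by rewrite (@dx_axis0 _ _ i)// !mul0r oppr0 mul0r.
under eq_bigr do rewrite diag.
rewrite big_ord_recl; congr (_ + _).
  have : 1 + dx ord0 u p ^+ 2 != 0 by rewrite gt_eqF// ltr_wpDr ?sqr_ge0.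
  by move=> h; field.
by apply: eq_bigr => i _; rewrite dx_axis0// expr0n/= mul0r subr0 mul1r.
Qed.

End Line.

(** * Radial sections of a solution *)

Section RadialSection.
Context {R : realType}.

Lemma within_continuous_comp (X Y Z : topologicalType) (A : set X) (B : set Y)
    (f : Y -> Z) (g : X -> Y) :
  {within B, continuous f} -> continuous g -> (forall x, A x -> B (g x)) ->
  {within A, continuous (f \o g)}.
Proof.
move=> /subspace_continuousP cf cg AB; apply/subspace_continuousP => x Ax S hS.
have hB : nbhs (g x) [set y | B y -> S (f y)] := cf _ (AB _ Ax) S hS.
have hA : nbhs x [set y | B (g y) -> S (f (g y))] := cg x _ hB.
by apply: (filterS _ hA) => y h /AB; exact: h.
Qed.

Context {m : nat}.
Notation V := 'rV[R]_m.+1.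

Definition radial (u : V * R -> R) (t r : R) := u (r *: axis ord0, t).

Definition ray (p : R * R) : V * R := (p.2 *: axis ord0, p.1).

Lemma continuous_pairf (X Y Z : topologicalType) (f : X -> Y) (g : X -> Z) :
  continuous f -> continuous g -> continuous (fun x => (f x, g x)).
Proof. by move=> cf cg x; exact: (cvg_pair (cf x) (cg x)). Qed.

Lemma continuous_ray : continuous ray.
Proof.
apply: continuous_pairf => p; last exact: cvg_fst.
apply: (@continuous_comp _ _ _ snd (fun r : R => r *: axis ord0)).
  exact: cvg_snd.
exact: scalel_continuous.
Qed.

Lemma radial_within T (f : V * R -> R) (A : set (R * R)) :
  {within slab T, continuous f} -> (forall p, A p -> 0 < p.1 <= T) ->
  {within A, continuous (fun p => radial f p.1 p.2)}.
Proof.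
by move=> cf AT; apply: within_continuous_comp cf continuous_ray _ => p /AT.
Qed.

Lemma radial_continuous T (f : V * R -> R) (t r : R) :
  {within slab T, continuous f} -> 0 < t <= T ->
  {for r, continuous (radial f t)}.
Proof.
move=> cf ht.
have c : {within setT, continuous (f \o (ray \o pair t))}.
  apply: within_continuous_comp cf _ _ => // s.
  apply: (@continuous_comp _ _ _ (pair t) ray); last exact: continuous_ray.
  by apply: continuous_pairf => x; [exact: cvg_cst|exact: cvg_id].
have /subspace_continuousP/(_ r I) cr := c.
move=> S /cr hS.
have hS' : nbhs r [set s | setT s -> S (radial f t s)] := hS.
by apply: (filterS _ hS') => s; exact.
Qed.

Lemma radial_bounded T (f : V * R -> R) (a b c d : R) :
  {within slab T, continuous f} -> 0 < a -> b < T ->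
  exists B : R, forall t r, a <= t <= b -> c <= r <= d -> `|radial f t r| <= B.
Proof.
move=> cf a0 bT.
pose A : set (R * R) := `[a, b]%classic `*` `[c, d]%classic.
have cA : compact A by apply: compact_setX; exact: segment_compact.
have fA : {within A, continuous (fun p => radial f p.1 p.2)}.
  by apply: radial_within cf _ => p [/=]; rewrite in_itv/= => ?; lra.
have /ex_strict_bound_gt0[B _ /= hB] :
    bounded_set ((fun p => radial f p.1 p.2) @` A).
  exact/compact_bounded/continuous_compact.
by exists B => t r ht hr; apply/ltW/hB; exists (t, r).
Qed.

Section Solution.
Variables (T : R) (u : V * R -> R).
Hypotheses (smu : smooth T u) (rsu : rotationally_symmetric T u).

Lemma radial_r (t r : R) : 0 < t <= T ->
  is_derive r 1 (radial u t) (radial (dx ord0 u) t r).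
Proof.
move=> ht; have := is_derive_along smu 0 r ord0 ht.
by rewrite add0r; under eq_fun do rewrite add0r.
Qed.

Lemma radial_rr (t r : R) : 0 < t <= T ->
  is_derive r 1 (radial (dx ord0 u) t) (radial (dx ord0 (dx ord0 u)) t r).
Proof.
move=> ht; have := is_derive_dx_along smu 0 r ord0 ord0 ht.
by rewrite add0r; under eq_fun do rewrite add0r.
Qed.

Lemma solution_profile : profile T (radial u) (radial (dx ord0 u))
  (radial (dx ord0 (dx ord0 u))) (radial (dt T u)).
Proof.
have [cu _ cdd cdt] := smooth_continuous smu.
have W t : 0 < t < T -> 0 < t <= T by move=> /andP[-> /ltW->].
split=> [t r ht _|t r ht _|t r ht _|t r ht _|t r ht _|a b N a0 bT].
- by apply: radial_r; exact: W.
- by apply: radial_rr; exact: W.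
- exact: is_derive_time.
- by apply: radial_continuous (W _ ht).
- by apply: radial_continuous cdt (W _ ht).
- have [B1 h1] := radial_bounded 1 N cu a0 bT.
  have [B2 h2] := radial_bounded 1 N cdt a0 bT.
  exists (Num.max B1 B2) => t r ht hr.
  by rewrite !le_max h1// h2// orbT.
Qed.

Lemma radial_equation (t r : R) : graphical_mcf T u -> 0 < t <= T -> 0 < r ->
  radial (dt T u) t r = radial_mcf m%:R r (radial (dx ord0 u) t r)
    (radial (dx ord0 (dx ord0 u)) t r).
Proof.
move=> mcf ht r0; rewrite /radial mcf_axis// /radial_mcf; congr (_ + _).
under eq_bigr do rewrite (dxx_axis smu rsu)//.
by rewrite sumr_const card_ord -[LHS]mulr_natl mulrA mulrAC.
Qed.

Lemma radial_enorm x t : 0 < t <= T -> u (x, t) = radial u t (enorm x).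
Proof.
move=> ht; apply: rsu => //.
by rewrite enorm_axis ger0_norm// enorm_ge0.
Qed.

End Solution.

(** Adding M + c t leaves the space derivatives unchanged, hence turns a
solution into a strict supersolution when c > 0. *)
Lemma profile_shift T U P Q D (c M : R) : profile T U P Q D ->
  profile T (fun t r => U t r + (M + t * c)) P Q (fun t r => D t r + c).
Proof.
move=> pr; split.
1-5: move=> t r ht hr.
- by rewrite -[P t r]addr0; apply: is_derive_addf (profile_r pr ht hr) _.
- exact (profile_rr pr ht hr).
- by apply: is_derive_addf (profile_t pr ht hr) _; exact: is_derive_affine.
- exact (profile_rr_continuous pr ht hr).
- apply: continuous_atD; last exact: continuous_at_cst.
  exact (profile_t_continuous pr ht hr).
- move=> a b N a0 bT; have [B hB] := profile_bounded pr N a0 bT.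
  exists (B + (`|M| + `|b| * `|c|) + `|c|) => t r ht hr.
  have [hU hD] := hB _ _ ht hr.
  have tb : `|t| <= `|b| by rewrite !ger0_norm; lra.
  have tc : `|t * c| <= `|b| * `|c| by rewrite normrM ler_wpM2r.
  split; apply: le_trans (ler_normD _ _) _.
    have := ler_normD M (t * c); have := normr_ge0 c; lra.
  have := normr_ge0 M; have := mulr_ge0 (normr_ge0 b) (normr_ge0 c); lra.
Qed.

Lemma initial_close (u1 u2 : V * R -> R) (u0 : V -> R) (N e : R) :
  initial_data u1 u0 -> initial_data u2 u0 -> 0 < e ->
  exists2 s : R, 0 < s & forall t r : R, 0 < t <= s -> 0 <= r <= N ->
    `|radial u1 t r - radial u2 t r| <= e.
Proof.
move=> i1 i2 e0.
pose K : set V := (fun r : R => r *: axis ord0) @` `[0, N]%classic.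
have cK : compact K.
  apply: continuous_compact; last exact: segment_compact.
  by apply: continuous_subspaceT => r; exact: scalel_continuous.
have close u : initial_data u u0 ->
    \forall t \near (0 : R)^'+, forall r : R, 0 <= r <= N ->
      `|u0 (r *: axis ord0) - radial u t r| < e / 2.
  move=> /fam_cvgP /(_ K cK) /= iu.
  have : nbhs (u0 : {uniform` K -> R})
      [set h | forall y, K y -> ball (u0 y) (e / 2) (h y)].
    apply/uniform_nbhs; exists [set xy | ball xy.1 (e / 2) xy.2]; split.
      by rewrite -entourage_ballE; exists (e / 2) => //=; lra.
    by move=> h /= hh y Ky; exact: hh.
  move=> /iu /=; apply: filterS => t /= h r hr.
  by apply: (h (r *: axis ord0)); exists r => //; rewrite /= in_itv.
have [s1 /= s10 h1] := close _ i1.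
have [s2 /= s20 h2] := close _ i2.
exists (Num.min s1 s2 / 2) => [|t r /andP[t0 ts] hr].
  by rewrite divr_gt0// lt_min s10.
have ts1 : t < s1.
  have : Num.min s1 s2 <= s1 by rewrite ge_min lexx.
  lra.
have ts2 : t < s2.
  have : Num.min s1 s2 <= s2 by rewrite ge_min lexx orbT.
  lra.
have a1 : `|0 - t| < s1 by rewrite sub0r normrN gtr0_norm.
have a2 : `|0 - t| < s2 by rewrite sub0r normrN gtr0_norm.
have := h1 t a1 t0 r hr; have := h2 t a2 t0 r hr.
by rewrite !ltr_norml ler_norml; lra.
Qed.

End RadialSection.

(** * The maximum principle and uniqueness *)

Section Uniqueness.
Context {R : realType} {m : nat}.
Notation V := 'rV[R]_m.+1.
Variables (T : R) (u0 : V -> R) (u1 u2 : V * R -> R).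
Hypotheses (sm1 : smooth T u1) (sm2 : smooth T u2).
Hypothesis rs1 : rotationally_symmetric T u1.
Hypothesis rs2 : rotationally_symmetric T u2.
Hypotheses (mcf1 : graphical_mcf T u1) (mcf2 : graphical_mcf T u2).
Hypotheses (i1 : initial_data u1 u0) (i2 : initial_data u2 u0).

(** The penalty t e makes the inequality for the time derivative strict. *)
Definition gap (e t r : R) := radial u1 t r - radial u2 t r - t * e.

(** A bound of the gap on the unit sphere extends to the exterior, by comparing
u1 with the supersolution u2 + M + t e.  The positivity of M makes the
comparison hold for small times. *)
Lemma gap_exterior (e M t : R) : 0 < e -> 0 < M -> 0 < t < T ->
  (forall s : R, 0 < s <= t -> gap e s 1 <= M) ->
  forall r, 1 <= r -> gap e t r <= M.
Proof.
move=> e0 M0 ht hb r r1.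
have pr1 := solution_profile sm1.
have pr2 := profile_shift e M (solution_profile sm2).
have cmp := exterior_comparison (ler0n R m) pr1 pr2 ht.
suff : radial u1 t r <= radial u2 t r + (M + t * e) by rewrite /gap; lra.
apply: cmp r1 => [s {}r hs r1|s {}r hs r1|s hs|N].
- by rewrite (radial_equation sm1 rs1 mcf1)//; lra.
- by rewrite (radial_equation sm2 rs2 mcf2)//; lra.
- by have := hb _ hs; rewrite /gap; lra.
have [s s0 hs] := initial_close N i1 i2 M0.
exists s => // t' q ht' _ hq.
have /(hs _ _ ht') : 0 <= q <= N by lra.
have : 0 < t' * e by rewrite mulr_gt0//; lra.
by rewrite ler_norml; lra.
Qed.

(** The gap has no maximum over space and over the times up to t: there the
gradients agree, so mcf_axis applies to both solutions with the same
nonnegative coefficients, and the second derivative test in each coordinate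
direction gives U1_t <= U2_t, against U1_t - U2_t >= e. *)
Lemma gap_max_absurd (e M t r : R) : 0 < e -> 0 < t < T -> gap e t r = M ->
  (forall s : R, 0 < s <= t -> gap e s r <= M) ->
  (forall r' : R, 0 <= r' -> gap e t r' <= M) -> False.
Proof.
move=> e0 ht gM gt gr.
have ht' : 0 < t <= T by lra.
pose p : V * R := (r *: axis ord0, t).
have t_ge : 0 <= dt T u1 p - dt T u2 p - e.
  apply: (@left_max_derivative _ (fun s => gap e s r) t).
    by case/andP: ht.
    apply: is_derive_subf.
      by apply: is_derive_subf; apply: is_derive_time.
    have := is_derive_affine 0 e t.
    by under eq_fun do rewrite add0r.
  by move=> s hs; rewrite gM; exact: gt.
have space i : dx i u1 p - dx i u2 p = 0 /\
    dx i (dx i u1) p - dx i (dx i u2) p <= 0.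
  pose y : V := r *: axis ord0.
  have d1 := is_derive_along sm1 y _ i ht'.
  have d2 := is_derive_along sm2 y _ i ht'.
  have dd1 := is_derive_dx_along sm1 y 0 i i ht'.
  have dd2 := is_derive_dx_along sm2 y 0 i i ht'.
  have := @second_derivative_test R
    (fun s => u1 (y + s *: axis i, t) - u2 (y + s *: axis i, t))
    (fun s => dx i u1 (y + s *: axis i, t) - dx i u2 (y + s *: axis i, t))
    _ (fun s => is_derive_subf (d1 s) (d2 s)) (is_derive_subf dd1 dd2).
  rewrite scale0r addr0; apply => s.
  have E x : u1 (x, t) - u2 (x, t) = gap e t (enorm x) + t * e.
    by rewrite (radial_enorm rs1)// (radial_enorm rs2)// /gap subrK.
  rewrite E -/(radial u1 t r) -/(radial u2 t r).
  (* Rotational symmetry turns the bound along the axis into one at every x. *)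
  have := gr _ (enorm_ge0 (y + s *: axis i)).
  by move: gM; rewrite /gap; lra.
have grad0 i : dx i u1 p = dx i u2 p.
  by apply/eqP; rewrite -subr_eq0; case: (space i) => ->.
have hess i : dx i (dx i u1) p <= dx i (dx i u2) p.
  by rewrite -subr_le0; case: (space i).
have : dt T u1 p <= dt T u2 p.
  rewrite /p (mcf_axis sm1 rs1 _ mcf1 ht') (mcf_axis sm2 rs2 _ mcf2 ht').
  rewrite -/p grad0; apply: lerD; last by apply: ler_sum => i _.
  by rewrite ler_wpM2r// invr_ge0 addr_ge0 ?sqr_ge0.
by lra.
Qed.

(** If the gap is positive somewhere in the unit ball, it attains a positive
maximum there: near t = 0 it is too small, so compactness applies.  By
gap_exterior this is a maximum over all of space.  If it is nonpositive in
the ball, gap_exterior shows that it is arbitrarily small outside. *)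
Lemma gap_le0 (e t r : R) : 0 < e -> 0 < t < T -> 0 <= r -> gap e t r <= 0.
Proof.
move=> e0 ht r0; have [//|gpos] := leP (gap e t r) 0; exfalso.
have [inner|] :=
  pselect (forall s q : R, 0 < s <= t -> 0 <= q <= 1 -> gap e s q <= 0).
  have r1 : 1 <= r.
    rewrite leNgt; apply/negP => r1.
    have : gap e t r <= 0 by apply: inner; lra.
    by lra.
  have g2 : 0 < gap e t r / 2 by lra.
  have : gap e t r <= gap e t r / 2.
    apply: gap_exterior => // s hs.
    by apply: le_trans (ltW g2); apply: inner => //; lra.
  by lra.
move=> /existsNP[s0 /existsNP[q0 /not_implyP[hs0 /not_implyP[hq0 /negP]]]].
rewrite -ltNge => mu0.
have [s1 s10 hs1] := initial_close 1 i1 i2 (divr_gt0 mu0 (ltr0n _ 2)).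
have small s q : 0 < s <= s1 -> 0 <= q <= 1 -> gap e s q < gap e s0 q0.
  move=> hs hq; have := hs1 _ _ hs hq.
  have : 0 < s * e by rewrite mulr_gt0//; lra.
  by rewrite ler_norml /gap; lra.
have s10' : s1 < s0.
  rewrite ltNge; apply/negP => h; have := small s0 q0.
  by rewrite ltxx => abs; have : false by [apply: abs; lra].
pose A : set (R * R) := `[s1, t]%classic `*` `[0, 1]%classic.
have cA : compact A by apply: compact_setX; exact: segment_compact.
have AT p : A p -> 0 < p.1 <= T by move=> [/=]; rewrite in_itv/= => ?; lra.
have gA : {within A, continuous (fun p => gap e p.1 p.2)}.
  have [c1 _ _ _] := smooth_continuous sm1.
  have [c2 _ _ _] := smooth_continuous sm2.
  have k1 := radial_within c1 AT; have k2 := radial_within c2 AT.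
  have k3 : {within A, continuous (fun p : R * R => p.1 * e)}.
    apply: continuous_subspaceT => p; apply: cvgM; first exact: cvg_fst.
    exact: cvg_cst.
  by move=> p; apply: cvgB (k3 p); apply: cvgB; [exact: k1|exact: k2].
have A0 : A !=set0 by exists (s0, q0); split; rewrite /= in_itv/=; lra.
have [[ts rs]] := compact_EVT_max A0 cA gA.
rewrite inE => -[/=]; rewrite !in_itv/= => hts hrs gmax.
have muM : gap e s0 q0 <= gap e ts rs.
  by apply: (gmax (s0, q0)); rewrite inE; split; rewrite /= in_itv/=; lra.
have inner s q : 0 < s <= t -> 0 <= q <= 1 -> gap e s q <= gap e ts rs.
  move=> hs hq; have [ss1|s1s] := leP s s1.
    by apply: le_trans muM; apply/ltW/small => //; lra.
  by apply: (gmax (s, q)); rewrite inE; split; rewrite /= in_itv/=; lra.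
apply: (@gap_max_absurd e (gap e ts rs) ts rs) => //; first by lra.
  by move=> s hs; apply: inner; lra.
move=> q q0'; have [q1|q1] := leP q 1; first by apply: inner; lra.
apply: gap_exterior => //; [by lra|by lra| |by lra].
by move=> s hs; apply: inner; lra.
Qed.

Lemma solution_le (x : V) (t : R) : 0 < t < T -> u1 (x, t) <= u2 (x, t).
Proof.
move=> ht; have ht' : 0 < t <= T by lra.
rewrite (radial_enorm rs1)// (radial_enorm rs2)//.
apply/ler_addgt0Pr => d d0.
have t0 : 0 < t by lra.
have := @gap_le0 (d / t) t (enorm x) (divr_gt0 d0 t0) ht (enorm_ge0 x).
have tdt : t * (d / t) = d by rewrite mulrC divfK// gt_eqF.
by rewrite /gap tdt; lra.
Qed.

End Uniqueness.

Theorem theorem1p2 (R : realType) (n : nat) (T : R)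
    (u0 : 'rV[R]_n -> R) (u1 u2 : 'rV[R]_n * R -> R) :
  (1 <= n)%N -> 0 < T ->
  lipschitz_continuous u0 ->
  smooth T u1 -> smooth T u2 ->
  rotationally_symmetric T u1 -> rotationally_symmetric T u2 ->
  graphical_mcf T u1 -> graphical_mcf T u2 ->
  initial_data u1 u0 -> initial_data u2 u0 ->
  forall (x : 'rV[R]_n) (t : R), 0 < t <= T -> u1 (x, t) = u2 (x, t).
Proof.
case: n u0 u1 u2 => [//|m] u0 u1 u2 _ T0 _ sm1 sm2 rs1 rs2 mcf1 mcf2 i1 i2 x.
have lt_T t : 0 < t < T -> u1 (x, t) = u2 (x, t).
  move=> ht; apply/le_anti.
  by rewrite (solution_le sm1 sm2 rs1 rs2 mcf1 mcf2 i1 i2)//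
    (solution_le sm2 sm1 rs2 rs1 mcf2 mcf1 i2 i1).
move=> t /andP[t0]; rewrite le_eqVlt => /predU1P[->|tT];
  last by apply: lt_T; lra.
have left_lim u : smooth T u -> u (x, s) @[s --> T^'-] --> u (x, T).
  move=> /smooth_continuous[cu _ _ _] S hS.
  have /subspace_continuousP/(_ (x, T)) := cu.
  move=> /(_ _ _ hS); rewrite /slab/= T0 lexx => /(_ isT) hu.
  have hu' : nbhs (x, T) [set p | slab T p -> S (u p)] := hu.
  have cx : continuous (fun s : R => (x, s)).
    by apply: continuous_pairf => s; [exact: cvg_cst|exact: cvg_id].
  have hs : nbhs T [set s | slab T (x, s) -> S (u (x, s))] := cx T _ hu'.
  have h0 : \forall s \near T^'-, 0 < s by apply: nbhs_left_gt.
  have h1 : \forall s \near T^'-, s < T by apply: nbhs_left_lt.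
  have h2 : \forall s \near T^'-, slab T (x, s) -> S (u (x, s)).
    by apply: cvg_within; exact: hs.
  have h3 : \forall s \near T^'-, S (u (x, s)).
    by apply: filterS3 h0 h1 h2 => s s0 sT; apply; rewrite /slab/= s0 ltW.
  exact: h3.
apply: (@cvg_unique _ _ (u1 (x, s) @[s --> T^'-])); first exact: norm_hausdorff.
  exact: left_lim.
apply: cvg_trans (left_lim _ sm2); apply: near_eq_cvg.
near=> s; rewrite lt_T//; apply/andP; split; near: s; first exact: nbhs_left_gt.
exact: nbhs_left_lt.
Unshelve. all: by end_near. Qed.
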